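(* Let $k$ be a field, and let $A_1,\dots,A_n$ be a sequence of $n\ge 5$ distinct points in $\mathbb{A}^2(k)$. With indices considered modulo $n$, define $l_i=\langle A_{i-1},A_{i+1}\rangle$. Assume that for all $i$: (i) $A_i\notin l_{i-2},\ A_i\notin l_i,\ A_i\notin l_{i+2}$; (ii) $l_{i-1}\ne l_{i+1}$; (iii) $l_i\nparallel l_{i+1}$. Set $B_{i,i+1}=l_i\cap l_{i+1}$, $C_i=[A_{i-1},B_{i-1,i}\mid B_{i,i+1},A_{i+1}]$ (a finite or infinite point of $l_i$), and let $g_i=\langle A_i,C_i\rangle$ be the axis through $A_i$. If the $n-3$ axes $g_1,g_2,\dots,g_{n-3}$ lie in a pencil, then the remaining three axes $g_{n-2},g_{n-1},g_n$ lie in the same pencil (so that all of $g_1,\dots,g_n$ lie in a pencil).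
   Context: The affine plane $\mathbb{A}^2(k)$ over an arbitrary field $k$ is viewed as embedded in $\mathbb{P}^2(k)$; lines are projective lines, ''finite'' points are the points of $\mathbb{A}^2(k)$, and two lines different from the line at infinity are parallel if their intersection point is at infinity. $\langle X,Y\rangle$ is the line through the distinct points $X,Y$. Lines lie in a pencil if they are concurrent or parallel, i.e. if they have a common point in $\mathbb{P}^2(k)$. Axis: let $(P,Q)$ and $(R,S)$ be two pairs of finite points on a line $l$ (with $P=Q$ or $R=S$ allowed, but neither $R$ nor $S$ coinciding with $P$ or $Q$) and let $A\notin l$ be a finite point. Let $l_P$ be the line through $P$ parallel to $\langle A,R\rangle$, $l_S$ the line through $S$ parallel to $\langle A,Q\rangle$, and $B=l_P\cap l_S$. The line $g=\langle A,B\rangle$ is the axis of the configuration. The (possibly infinite) point $g\cap l$ does not depend on the choice of $A$ and is denoted $[P,Q\mid R,S]$; equivalently, it is the point $C$ of the projective line $l$ with $\frac{C-Q}{C-R}=\frac{Q-S}{R-P}$, where the ratio of two parallel vectors is an element of $k$ and $\frac{C-Q}{C-R}=1$ by convention if $C$ is at infinity. Under assumptions (i)–(iii) the points $B_{i,i+1}$ are well-defined finite points, $A_{i-1},B_{i-1,i},B_{i,i+1},A_{i+1}$ are four distinct points of $l_i$, and $A_i\notin l_i$, so $C_i$ and $g_i$ are defined. *)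

(* Defs.v *)
(* MathComp *)
From HB Require Import structures.
From mathcomp Require Import all_boot all_order all_algebra.

Set Implicit Arguments.
Unset Strict Implicit.
Unset Printing Implicit Defensive.

Import GRing.Theory.
Local Open Scope ring_scope.

(* The points and lines of P^2(k) are the subspaces of k^3 of dimension 1 and
   2. Thus <X, Y> is the subspace sum X + Y of two distinct points, the
   intersection point of two distinct lines is l :&: m, and incidence is
   inclusion. *)

Definition is_point (k : fieldType) (X : {vspace 'rV[k]_3}) : bool :=
  \dim X == 1%N.

(* (x, y) |-> (x : y : 1) *)
Definition aff (k : fieldType) (a : 'rV[k]_2) : {vspace 'rV[k]_3} :=
  <[row_mx a (1 : 'rV[k]_1) : 'rV[k]_3]>%VS.

(* the points (x : y : 0) *)
Definition linf (k : fieldType) : {vspace 'rV[k]_3} :=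
  (<[delta_mx 0%R 0%R]> + <[delta_mx 0%R 1%R]>)%VS.

(* Meant for distinct lines other than linf; false when l = m != linf. *)
Definition parallel (k : fieldType) (l m : {vspace 'rV[k]_3}) : bool :=
  (l :&: m <= linf k)%VS.

(* For a line m != linf, the line through the finite point P having the same
   point at infinity as m. *)
Definition par_through (k : fieldType) (P m : {vspace 'rV[k]_3}) :
    {vspace 'rV[k]_3} :=
  (P + (m :&: linf k))%VS.

Definition axis (k : fieldType) (A P Q R S : {vspace 'rV[k]_3}) :
    {vspace 'rV[k]_3} :=
  (A + (par_through P (A + R) :&: par_through S (A + Q)))%VS.

(* C = [P, Q | R, S], for finite points P, Q, R, S of the line l such that
   neither R nor S is P or Q. The auxiliary point a is arbitrary: C does not
   depend on it. *)
Definition is_bracket (k : fieldType) (l P Q R S C : {vspace 'rV[k]_3}) : Prop :=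
  exists2 a : 'rV[k]_2,
    ~~ (aff a <= l)%VS & C = (axis (aff a) P Q R S :&: l)%VS.

(* The pencil of all lines through the (finite or infinite) point X. *)
Definition pencil (k : fieldType) (X : {vspace 'rV[k]_3}) :
    pred {vspace 'rV[k]_3} :=
  fun g => (\dim g == 2%N) && (X <= g)%VS.

(* Main.v *)
(* Write p_i = (A_i : 1) in k^3 and let X = <x>. The line g_i passes through X
   if and only if
     [p_(i-1), p_i, p_(i+2)] [p_(i-2), p_i, x]
       = [p_(i-2), p_i, p_(i+1)] [p_i, p_(i+2), x],
   where [ , , ] is the determinant. This says that the covectors
   N_i = cross(p_(i-1), p_(i+1)) / [p_(i-1), p_(i+1), x] of the lines l_i satisfy
   N_(i+1).p_(i-1) = N_(i-1).p_(i+1), which is a symmetry property. There is a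
   unique symmetric map S sending x to the line at infinity, p_0 to N_0 and p_1
   to N_1, and the equations for i = 1, ..., n - 3 give inductively
   S p_i = N_i for i <= n - 2: the vertices are the poles of the lines l_i for
   a polarity centered at X. Since p_(n-1) lies on l_0 and on l_(n-2), the line
   S p_(n-1) passes through p_0 and p_(n-2), so p_(n-1) is the pole of l_(n-1),
   and the symmetry of S yields the remaining three equations. *)
Require Import Defs.
From HB Require Import structures.
From mathcomp Require Import all_boot all_order all_algebra.
From mathcomp Require Import ring zify.

Set Implicit Arguments.
Unset Strict Implicit.
Unset Printing Implicit Defensive.

Import GRing.Theory.
Local Open Scope ring_scope.

(** * Determinants, lines and their intersections in k^3 *)

Section Space.
Variable k : fieldType.
Implicit Types (x y z v a b c d e f n : 'rV[k]_3).

(** The indices [j + 1] and [j + 2] wrap around in ['I_3], so one formula gives all three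
    coordinates. *)
Definition cross x y : 'rV[k]_3 :=
  \row_(j < 3) (x 0 (j + 1) * y 0 (j + 2) - x 0 (j + 2) * y 0 (j + 1)).

Definition dot x y : k := x 0 0 * y 0 0 + x 0 1 * y 0 1 + x 0 2 * y 0 2.

Definition det3 x y z : k := dot (cross x y) z.

(** The linear form whose kernel is the line at infinity. *)
Definition wt x : k := x 0 2.

Lemma ord3P (P : 'I_3 -> Prop) : P 0 -> P 1 -> P 2 -> forall j, P j.
Proof.
move=> P0 P1 P2; case=> [[|[|[|//]]] lt_j3].
- by rewrite (_ : Ordinal _ = 0) //; apply: val_inj.
- by rewrite (_ : Ordinal _ = 1) //; apply: val_inj.
- by rewrite (_ : Ordinal _ = 2) //; apply: val_inj.
Qed.

Lemma row3P x y : x 0 0 = y 0 0 -> x 0 1 = y 0 1 -> x 0 2 = y 0 2 -> x = y.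
Proof. by move=> e0 e1 e2; apply/rowP; apply: ord3P. Qed.

Lemma crossE x y :
  (cross x y 0 0 = x 0 1 * y 0 2 - x 0 2 * y 0 1) *
  (cross x y 0 1 = x 0 2 * y 0 0 - x 0 0 * y 0 2) *
  (cross x y 0 2 = x 0 0 * y 0 1 - x 0 1 * y 0 0).
Proof.
have e12 : 1 + 2 = 0 :> 'I_3 by apply: val_inj.
have e11 : 1 + 1 = 2 :> 'I_3 by apply: val_inj.
have e21 : 2 + 1 = 0 :> 'I_3 by apply: val_inj.
have e22 : 2 + 2 = 1 :> 'I_3 by apply: val_inj.
by rewrite !mxE !add0r e12 e11 e21 e22.
Qed.

Local Ltac coord := rewrite /det3 /dot /wt ?(crossE, mxE).

Lemma cramer3 x y z v : det3 x y z *: v =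
  det3 v y z *: x + det3 x v z *: y + det3 x y v *: z.
Proof. by apply: row3P; coord; ring. Qed.

(** Expansion of a covector in the basis dual to x, y, z. Free of division, it also holds when the
    determinant vanishes, which [pole_close] exploits. *)
Lemma dual_cramer3 x y z n : det3 x y z *: n =
  dot n x *: cross y z + dot n y *: cross z x + dot n z *: cross x y.
Proof. by apply: row3P; coord; ring. Qed.

Lemma det3_cyc x y z : det3 x y z = det3 y z x.
Proof. by coord; ring. Qed.

Lemma det3_swap x y z : det3 x z y = - det3 x y z.
Proof. by coord; ring. Qed.

Lemma det3_neq0_cross x y z : det3 x y z != 0 -> cross x y != 0.
Proof.
by apply: contraNneq => n0; rewrite /det3 n0; coord; apply/eqP; ring.
Qed.

Lemma mem_line2 x y v :
  reflect (exists s t, v = s *: x + t *: y) (v \in <[x]> + <[y]>)%VS.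
Proof.
apply: (iffP memv_addP) => [[_ /vlineP[s ->] [_ /vlineP[t ->] ->]]|].
  by exists s, t.
move=> [s [t ->]]; exists (s *: x); first by rewrite memvZ ?memv_line.
by exists (t *: y); rewrite ?memvZ ?memv_line.
Qed.

Lemma cross_neq0_det3 x y : cross x y != 0 -> exists z, det3 x y z != 0.
Proof.
move=> xy; have [j xyj] : exists j, cross x y 0 j != 0.
  apply/existsP; apply: contraNT xy; rewrite negb_exists => /forallP xy0.
  apply/eqP/rowP => j; rewrite [RHS]mxE; apply/eqP.
  by rewrite -[_ == _]negbK xy0.
exists (delta_mx 0 j); move: j xyj.
by apply: ord3P; rewrite /det3 /dot !mxE !eqxx /= ?mulr0 ?mulr1 ?addr0 ?add0r.
Qed.

Lemma mem_line x y v : cross x y != 0 ->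
  (v \in <[x]> + <[y]>)%VS = (det3 x y v == 0).
Proof.
move=> /cross_neq0_det3[z xyz].
apply/idP/eqP => [/mem_line2[s [t ->]]|xyv]; first by coord; ring.
have -> : v = (det3 x y z)^-1 *: (det3 x y z *: v).
  by rewrite scalerA mulVf ?scale1r.
by rewrite cramer3 xyv scale0r addr0 memvZ //; apply/mem_line2; do 2!eexists.
Qed.

Lemma mem_linf v : (v \in linf k) = (wt v == 0).
Proof.
apply/mem_line2/eqP => [[s [t ->]]|v0].
  by rewrite /wt !mxE /= !mulr0 addr0.
exists (v 0 0), (v 0 1).
apply: row3P; rewrite !mxE /= ?(mulr0, mulr1, addr0, add0r) //.
Qed.

Lemma vline_scale (s : k) v : s != 0 -> (<[s *: v]> = <[v]>)%VS.
Proof.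
move=> s0; apply/vspaceP => w; apply/vlineP/vlineP => [[t ->]|[t ->]].
  by exists (t * s); rewrite scalerA.
by exists (t / s); rewrite scalerA divfK.
Qed.

Lemma line_slide (s t : k) x y : s != 0 ->
  (<[s *: x + t *: y]> + <[y]> = <[x]> + <[y]>)%VS.
Proof.
move=> s0; apply/vspaceP => v; apply/mem_line2/mem_line2 => [] [a [b ->]].
  by exists (a * s), (a * t + b); rewrite scalerDr !scalerA scalerDl addrA.
exists (a / s), (b - a / s * t); rewrite scalerDr !scalerA scalerBl divfK //.
by rewrite -addrA [_ + (_ - _)]addrC subrK.
Qed.

Lemma meet_lines x y z : det3 x y z != 0 ->
  ((<[x]> + <[y]>) :&: (<[x]> + <[z]>) = <[x]>)%VS.
Proof.
move=> xyz; apply/eqP; rewrite eqEsubv subv_cap !addvSl !andbT.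
apply/subvP => v; rewrite memv_cap => /andP[/mem_line2[s [t ->]]].
rewrite mem_line; last first.
  apply: (@det3_neq0_cross _ _ y); apply: contraNneq xyz => e.
  by rewrite -[det3 _ _ _]opprK -oppr0 -e; apply/eqP; coord; ring.
have -> : det3 x z (s *: x + t *: y) = - (t * det3 x y z) by coord; ring.
rewrite oppr_eq0 mulf_eq0 (negPf xyz) orbF => /eqP->.
by rewrite scale0r addr0 memvZ ?memv_line.
Qed.

(** * Parallels, the axis construction and quadrilaterals *)

Lemma par_throughE a x P : wt a = 1 -> wt x = 1 -> a != x ->
  (par_through <[P]> (<[a]> + <[x]>) = <[P]> + <[x - a]>)%VS.
Proof.
rewrite /par_through => wa wx ax; congr (_ + _)%VS; apply/vspaceP => v.
rewrite memv_cap mem_linf.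
apply/andP/vlineP => [[/mem_line2[s [t ->]] /eqP e]|].
  exists t; suff -> : s = - t by rewrite scaleNr scalerBr addrC.
  apply/eqP; rewrite -addr_eq0 -e; move: wa wx; rewrite /wt !mxE => -> ->.
  by rewrite !mulr1.
move=> [s ->]; split.
  by apply/mem_line2; exists (- s), s; rewrite scaleNr scalerBr addrC.
by move: wa wx; rewrite /wt !mxE => -> ->; rewrite subrr mulr0.
Qed.

(** The two parallels meet in [D], which equals both (r - q) P + (R - a) and (r - q) S + (Q - a).
    The axis is spanned by a and [D], and D + a = (r - q) P + R lies on the line PS. Its weight r -
    q + 1 may vanish, so the infinite case needs no separate treatment. *)
Lemma axis_meet (q r : k) P S a :
  wt P = 1 -> wt S = 1 -> wt a = 1 -> det3 P S a != 0 -> r != 0 -> q != r ->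
  let Q := P + q *: (S - P) in let R := P + r *: (S - P) in
  (axis <[a]> <[P]> <[Q]> <[R]> <[S]> :&: (<[P]> + <[S]>)
   = <[(r - q) *: P + R]>)%VS.
Proof.
move=> wP wS wa PSa r0 qr Q R.
have rq0 : r - q != 0 by rewrite subr_eq0 eq_sym.
have wQ : wt Q = 1 by move: wP wS; rewrite /wt !mxE => -> ->; ring.
have wR : wt R = 1 by move: wP wS; rewrite /wt !mxE => -> ->; ring.
have aline s : a != P + s *: (S - P).
  by apply: contraNneq PSa => ->; apply/eqP; coord; ring.
rewrite /axis !par_throughE ?aline //.
pose D := (r - q) *: P + (R - a).
have eP : (<[P]> + <[R - a]> = <[D]> + <[R - a]>)%VS.
  by rewrite -(line_slide 1 _ _ rq0) scale1r.
have eS : (<[S]> + <[Q - a]> = <[D]> + <[Q - a]>)%VS.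
  rewrite -(line_slide 1 _ _ rq0) scale1r; congr (<[_]> + _)%VS.
  by apply: row3P; rewrite !mxE; ring.
rewrite eP eS meet_lines; last first.
  rewrite (_ : det3 _ _ _ = - (r - q) ^+ 2 * det3 P S a).
    by rewrite mulf_neq0 // oppr_eq0 expf_neq0.
  by coord; ring.
rewrite addvC.
have -> : D = 1 *: ((r - q) *: P + R) + (- 1) *: a.
  by apply: row3P; rewrite !mxE; ring.
rewrite line_slide ?oner_neq0 //.
have -> : (<[P]> + <[S]> = <[(r - q) *: P + R]> + <[P]>)%VS.
  rewrite addvC -(line_slide (r - q + 1 - r) _ _ r0); congr (<[_]> + _)%VS.
  by apply: row3P; rewrite !mxE; ring.
apply: meet_lines.
rewrite (_ : det3 _ _ _ = r * det3 P S a) ?mulf_neq0 //.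
by coord; ring.
Qed.

Lemma dim_line x y : cross x y != 0 -> \dim (<[x]> + <[y]>) = 2.
Proof.
move=> xy.
have x0 : x != 0.
  by apply: contraNneq xy => ->; apply/eqP/row3P; coord; ring.
have y0 : y != 0.
  by apply: contraNneq xy => ->; apply/eqP/row3P; coord; ring.
rewrite dimv_disjoint_sum ?dim_vline ?x0 ?y0 //.
apply/eqP; rewrite -subv0; apply/subvP => v; rewrite memv_cap memv0.
case/andP=> /vlineP[s ->] /vlineP[t sxty]; apply: contraNT xy.
rewrite scaler_eq0 negb_or => /andP[s0 _]; apply/eqP.
have -> : x = s^-1 *: (t *: y) by rewrite -sxty scalerA mulVf ?scale1r.
by apply: row3P; coord; ring.
Qed.

(* For points of weight 1, twice the signed area of the quadrilateral abcd. *)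
Definition quad a b c d : k := wt (cross (c - a) (d - b)).

Lemma quadE1 a b c d : wt a = 1 -> wt b = 1 -> wt c = 1 -> wt d = 1 ->
  quad a b c d = det3 a b d + det3 b c d.
Proof. by rewrite /quad; coord => -> -> -> ->; ring. Qed.

Lemma quadE2 a b c d : wt a = 1 -> wt b = 1 -> wt c = 1 -> wt d = 1 ->
  quad a b c d = det3 a c d + det3 a b c.
Proof. by rewrite /quad; coord => -> -> -> ->; ring. Qed.

(** The linear relation between four vectors of k^3, with b, d on one side and a, c on the other,
    exhibits the common point. *)
Lemma meet_diagonals a b c d : det3 a b d != 0 -> det3 a c d != 0 ->
  ((<[a]> + <[c]>) :&: (<[b]> + <[d]>)
   = <[det3 a c d *: b + det3 a b c *: d]>)%VS.
Proof.
move=> abd acd; set v := (_ + _).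
have vE : v = det3 a b d *: c + det3 b c d *: a.
  by apply: row3P; rewrite /v; coord; ring.
have -> : (<[a]> + <[c]> = <[v]> + <[a]>)%VS.
  by rewrite vE line_slide // addvC.
have -> : (<[b]> + <[d]> = <[v]> + <[d]>)%VS by rewrite /v line_slide.
apply: meet_lines.
rewrite (_ : det3 _ _ _ = - (det3 a c d * det3 a b d)).
  by rewrite oppr_eq0 mulf_neq0.
by rewrite /v; coord; ring.
Qed.

(** Hypotheses (i)-(iii) at five consecutive vertices: [gen_ace] is (ii), the two [quad] conditions
    are (iii), and the other determinants are (i). *)
Record generic_five a b c d e : Prop := GenericFive {
  gen_weight : [/\ wt a = 1, wt b = 1, wt c = 1, wt d = 1 & wt e = 1];
  gen_abd : det3 a b d != 0;
  gen_acd : det3 a c d != 0;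
  gen_bce : det3 b c e != 0;
  gen_bde : det3 b d e != 0;
  gen_bcd : det3 b c d != 0;
  gen_ace : det3 a c e != 0;
  gen_abcd : quad a b c d != 0;
  gen_bcde : quad b c d e != 0
}.

(* The equation of the axis through the middle vertex c, divided by
   det3 b c d. *)
Definition on_axis a b c d e x : Prop :=
  det3 b c e * det3 a c x = det3 a c d * det3 c e x.

(** * The axis through the middle one of five consecutive vertices *)

Section FivePoints.
Variables (a b c d e x : 'rV[k]_3).
Hypothesis gen : generic_five a b c d e.

Let wa : wt a = 1. Proof. by case: (gen_weight gen). Qed.
Let wb : wt b = 1. Proof. by case: (gen_weight gen). Qed.
Let wc : wt c = 1. Proof. by case: (gen_weight gen). Qed.
Let wd : wt d = 1. Proof. by case: (gen_weight gen). Qed.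
Let we : wt e = 1. Proof. by case: (gen_weight gen). Qed.
Let abd := gen_abd gen.
Let acd := gen_acd gen.
Let bce := gen_bce gen.
Let bde := gen_bde gen.
Let bcd := gen_bcd gen.
Let ace := gen_ace gen.
Let sa := gen_abcd gen.
Let sb := gen_bcde gen.

(** Parametrize the line bd by b + t (d - b). The two intersection points have parameters q =
    [det3 a b c / s] and r = [det3 b c e / s'], so [axis_meet] gives (1 - q) b + r d; clearing
    denominators yields the stated vector. *)
Lemma bracketE p : wt p = 1 -> ~~ (<[p]> <= <[b]> + <[d]>)%VS ->
  (axis <[p]> <[b]> ((<[a]> + <[c]>) :&: (<[b]> + <[d]>))
     ((<[b]> + <[d]>) :&: (<[c]> + <[e]>)) <[d]> :&: (<[b]> + <[d]>)
   = <[(quad b c d e * det3 a c d) *: b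
       + (quad a b c d * det3 b c e) *: d]>)%VS.
Proof.
move=> wp; rewrite -memvE mem_line; last first.
  apply: (@det3_neq0_cross _ _ c); rewrite -oppr_eq0 (_ : - _ = det3 b c d) //.
  by coord; ring.
move=> pbd; rewrite !meet_diagonals //.
set s := quad a b c d; set s' := quad b c d e.
have s0 : s != 0 by []; have s0' : s' != 0 by [].
have -> : <[det3 a c d *: b + det3 a b c *: d]>%VS
    = <[b + (det3 a b c / s) *: (d - b)]>%VS.
  rewrite -[RHS](vline_scale _ s0); congr <[_]>%VS.
  rewrite scalerDr scalerA mulrCA divff // mulr1 {1}/s quadE2 //.
  by apply: row3P; coord; ring.
have -> : <[det3 b d e *: c + det3 b c d *: e]>%VS
    = <[b + (det3 b c e / s') *: (d - b)]>%VS.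
  rewrite -[RHS](vline_scale _ s0'); congr <[_]>%VS.
  rewrite scalerDr scalerA mulrCA divff // mulr1 {1}/s' quadE1 //.
  by apply: row3P; coord; ring.
(* The difference r - q is nonzero by [gen_ace] and [gen_bcd], as [axis_meet] requires. *)
have ratio : det3 b c e / s' - det3 a b c / s =
    det3 a c e * det3 b c d / (s' * s).
  have -> : det3 a c e * det3 b c d = det3 b c e * s - det3 a b c * s'.
    by rewrite /s /s' (quadE2 wa wb wc wd) (quadE1 wb wc wd we); coord; ring.
  by field; rewrite s0 s0'.
rewrite axis_meet ?mulf_neq0 ?invr_eq0 //; last first.
  by rewrite eq_sym -subr_eq0 ratio !mulf_neq0 ?invr_eq0 ?mulf_neq0.
rewrite -[LHS](vline_scale _ (mulf_neq0 s0' s0)); congr <[_]>%VS.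
have -> : det3 a c d = s - det3 a b c by rewrite /s quadE2 // addrK.
by apply: row3P; rewrite !mxE; field; rewrite s0 s0'.
Qed.

(** Up to sign, the right side is the determinant of c, the bracket point of [bracketE] and x; the
    nonzero factor [det3 b c d] splits off. *)
Lemma axis_equation :
  det3 b c d * (det3 b c e * det3 a c x - det3 a c d * det3 c e x) =
  quad b c d e * det3 a c d * det3 b c x
  - quad a b c d * det3 b c e * det3 c d x.
Proof.
rewrite (quadE1 wb wc wd we) (quadE2 wa wb wc wd).
by coord; ring.
Qed.

(** For x on the axis and on the line ac, this form forces x onto cd. The next lemma is its mirror
    image. *)
Lemma axis_equation_l :
  det3 b c e * det3 a c x - det3 a c d * det3 c e x =
  quad b c d e * det3 a c x - det3 a c e * det3 c d x.
Proof. by rewrite (quadE1 wb wc wd we); coord; ring. Qed.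

Lemma axis_equation_r :
  det3 b c e * det3 a c x - det3 a c d * det3 c e x =
  det3 a c e * det3 b c x - quad a b c d * det3 c e x.
Proof. by rewrite (quadE2 wa wb wc wd); coord; ring. Qed.

Lemma axis_pencil p : wt p = 1 -> ~~ (<[p]> <= <[b]> + <[d]>)%VS ->
  let g := (<[c]> + (axis <[p]> <[b]> ((<[a]> + <[c]>) :&: (<[b]> + <[d]>))
     ((<[b]> + <[d]>) :&: (<[c]> + <[e]>)) <[d]> :&: (<[b]> + <[d]>)))%VS in
  reflect (on_axis a b c d e x) (g \in pencil <[x]>%VS).
Proof.
move=> wp pbd /=; rewrite bracketE //; set v := (_ + _).
have cv : cross c v != 0.
  apply: (@det3_neq0_cross _ _ b).
  rewrite (_ : det3 _ _ _ = quad a b c d * det3 b c e * det3 b c d).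
    by rewrite !mulf_neq0.
  by rewrite /v; coord; ring.
rewrite unfold_in /= dim_line // eqxx -memvE mem_line //.
have -> : det3 c v x =
    - (det3 b c d * (det3 b c e * det3 a c x - det3 a c d * det3 c e x)).
  by rewrite axis_equation /v; coord; ring.
rewrite oppr_eq0 mulf_eq0 (negPf bcd) /= subr_eq0.
exact: eqP.
Qed.

Hypothesis (eq_c : on_axis a b c d e x).

(** The bracket point is neither b nor d, so the axis differs from bc and cd and meets each of them
    only in c. *)
Lemma axis_eq_step : (det3 b c x == 0) = (det3 c d x == 0).
Proof.
have := axis_equation; rewrite eq_c subrr mulr0 => /eqP.
rewrite eq_sym subr_eq0 => /eqP e0.
have sr : quad b c d e * det3 a c d != 0 by rewrite mulf_neq0.
have sq : quad a b c d * det3 b c e != 0 by rewrite mulf_neq0.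
by rewrite -(mulrI_eq0 _ (mulfI sr)) e0 (mulrI_eq0 _ (mulfI sq)).
Qed.

Lemma axis_eq_side : det3 a c x != 0 -> det3 b c x != 0.
Proof.
apply: contraNneq => bcx0; have cdx0 : det3 c d x = 0.
  by apply/eqP; rewrite -axis_eq_step bcx0.
rewrite -(mulrI_eq0 _ (mulfI bcd)).
rewrite (_ : _ * _ = det3 a c d * det3 b c x - det3 a b c * det3 c d x).
  by rewrite bcx0 cdx0 !mulr0 subr0.
by coord; ring.
Qed.

End FivePoints.

Lemma det3_col0 a b c x : det3 a b c != 0 ->
  det3 a b x = 0 -> det3 a c x = 0 -> det3 b c x = 0 -> x = 0.
Proof.
move=> abc abx acx bcx; apply: (scalerI abc); rewrite scaler0 cramer3.
have -> : det3 a x c = - det3 a c x by coord; ring.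
by rewrite (det3_cyc x) abx acx bcx oppr0 !scale0r !addr0.
Qed.

Lemma mulf_eq_eq0 (u v s t : k) : u != 0 -> v != 0 -> u * s = v * t ->
  (s == 0) = (t == 0).
Proof.
by move=> u0 v0 e; rewrite -(mulrI_eq0 _ (mulfI u0)) e (mulrI_eq0 _ (mulfI v0)).
Qed.

(* Otherwise x would lie on all three sides of the triangle cde or bcd. *)
Lemma two_axes_avoid_sides a b c d e f x : x != 0 ->
  generic_five a b c d e -> generic_five b c d e f ->
  on_axis a b c d e x -> on_axis b c d e f x ->
  det3 a c x != 0 /\ det3 b d x != 0.
Proof.
move=> x0 gc gd eq_c eq_d.
split; apply: contraNneq x0 => e0; apply/eqP.
  have cex0 : det3 c e x = 0.
    apply/eqP; rewrite -(mulf_eq_eq0 _ _ eq_c) ?e0 ?(gen_acd gc) //.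
    exact: (gen_bce gc).
  have cdx0 : det3 c d x = 0.
    apply/eqP; have := axis_equation_l x gc; rewrite eq_c subrr e0 mulr0 sub0r.
    by move/esym/eqP; rewrite oppr_eq0 mulf_eq0 (negPf (gen_ace gc)).
  have dex0 : det3 d e x = 0.
    by apply/eqP; rewrite -(axis_eq_step gd eq_d) cdx0.
  exact: (det3_col0 (gen_bcd gd)).
(* Mirror image of the first half: x would lie on bd, cd and bc. *)
have dfx0 : det3 d f x = 0.
  apply/eqP; rewrite -(mulf_eq_eq0 _ _ eq_d) ?e0 ?(gen_acd gd) //.
  exact: (gen_bce gd).
have cdx0 : det3 c d x = 0.
  apply/eqP; have := axis_equation_r x gd; rewrite eq_d subrr dfx0 mulr0 subr0.
  by move/esym/eqP; rewrite mulf_eq0 (negPf (gen_ace gd)).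
have bcx0 : det3 b c x = 0.
  by apply/eqP; rewrite (axis_eq_step gc eq_c) cdx0.
exact: (det3_col0 (gen_bcd gc)).
Qed.

(** * Polarities given by symmetric maps *)

Lemma symmetric_extension x y z nx ny nz : det3 x y z != 0 ->
  dot nx y = dot ny x -> dot nx z = dot nz x -> dot ny z = dot nz y ->
  exists S : 'rV[k]_3 -> 'rV[k]_3,
    [/\ forall u v, dot (S u) v = dot (S v) u, S x = nx, S y = ny & S z = nz].
Proof.
move=> d0 exy exz eyz.
have dotD u v w : dot u (v + w) = dot u v + dot u w by coord; ring.
have dotZ t u v : dot u (t *: v) = t * dot u v by coord; ring.
have dotDl u v w : dot (v + w) u = dot v u + dot w u by coord; ring.
have dotZl t u v : dot (t *: v) u = t * dot v u by coord; ring.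
(* Linear extension from the basis x, y, z, with coordinates given by Cramer's rule. *)
pose S u := (det3 x y z)^-1 *:
  (det3 u y z *: nx + det3 x u z *: ny + det3 x y u *: nz).
have det0 u v : [/\ det3 u u v = 0, det3 u v u = 0 & det3 v u u = 0].
  by split; coord; ring.
have [yyz _ _] := det0 y z; have [_ zyz _] := det0 z y.
have [_ xyx _] := det0 x y; have [xxz _ _] := det0 x z.
have [_ _ xyy] := det0 y x; have [_ _ xzz] := det0 z x.
exists S; split=> [u v|||]; first last.
- by rewrite /S zyz xzz !scale0r !add0r scalerA mulVf ?scale1r.
- by rewrite /S yyz xyy !scale0r addr0 add0r scalerA mulVf ?scale1r.
- by rewrite /S xxz xyx !scale0r !addr0 scalerA mulVf ?scale1r.
(* One factor for each of u and v, so that both can be expanded by [cramer3]. *)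
apply: (mulfI d0); apply: (mulfI d0).
have dS w w' : det3 x y z * dot (S w) w' =
    det3 w y z * dot nx w' + det3 x w z * dot ny w' + det3 x y w * dot nz w'.
  by rewrite -dotZl scalerA divff // scale1r !dotDl !dotZl.
rewrite -[in LHS]dotZ -[in RHS]dotZ ![det3 x y z *: _]cramer3.
have distr (t c1 c2 c3 p1 p2 p3 : k) : t * (c1 * p1 + c2 * p2 + c3 * p3) =
    c1 * (t * p1) + c2 * (t * p2) + c3 * (t * p3) by ring.
by rewrite !dotD !dotZ distr [RHS]distr !dS exy exz eyz; ring.
Qed.

(* The vertex b is the pole of the line ac, for the polarity S centered at x. *)
Definition pole x (S : 'rV[k]_3 -> 'rV[k]_3) a b c :=
  det3 a c x != 0 /\ det3 a c x *: S b = cross a c.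

(** Extend from the basis x, b, c. Compatibility with x is the normalization of the covectors at x;
    compatibility of b with c holds because c lies on ac and b on bd. *)
Lemma polarity_exists a b c d x : wt b = 1 -> wt c = 1 ->
  det3 a c x != 0 -> det3 b d x != 0 -> det3 b c x != 0 ->
  exists S, [/\ forall u v, dot (S u) v = dot (S v) u,
    forall v, dot (S x) v = wt v, pole x S a b c & pole x S b c d].
Proof.
move=> wb wc acx bdx bcx.
have dotZl t u v : dot (t *: v) u = t * dot v u by coord; ring.
have om v : dot (delta_mx 0 2) v = wt v.
  by rewrite /dot /wt !mxE /= !mul0r mul1r !add0r.
have [] := @symmetric_extension x b c (delta_mx 0 2)
  ((det3 a c x)^-1 *: cross a c) ((det3 b d x)^-1 *: cross b d).
- by rewrite det3_cyc.
- by rewrite om wb dotZl mulVf.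
- by rewrite om wc dotZl mulVf.
- rewrite !dotZl (_ : dot (cross a c) c = 0); last by coord; ring.
  by rewrite (_ : dot (cross b d) b = 0) ?mulr0 //; coord; ring.
move=> S [S_sym Sx Sb Sc]; exists S; split=> // [v||].
- by rewrite Sx om.
- by rewrite /pole Sb scalerA divff ?scale1r.
- by rewrite /pole Sc scalerA divff ?scale1r.
Qed.

Section Polarity.
Variables (x : 'rV[k]_3) (S : 'rV[k]_3 -> 'rV[k]_3).
Hypothesis S_sym : forall u v, dot (S u) v = dot (S v) u.
Hypothesis S_x : forall v, dot (S x) v = wt v.

Local Notation pole := (pole x S).

Lemma pole_dot a b c v : pole a b c -> det3 a c x * dot (S b) v = det3 a c v.
Proof. by case=> _ e; rewrite [RHS]/det3 -e; coord; ring. Qed.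

(** Both covectors are compared at the basis b, c, x: at x by [wt d = 1], at c because d lies on the
    polar bd of c, and at b by the symmetry of [S] and the axis equation. *)
Lemma pole_step a b c d e : det3 b c x != 0 -> det3 c e x != 0 -> wt d = 1 ->
  on_axis a b c d e x -> pole a b c -> pole b c d -> pole c d e.
Proof.
move=> bcx cex wd eq_c pb pc; split=> //.
have dotZl t u v : dot (t *: v) u = t * dot v u by coord; ring.
apply: (scalerI bcx); rewrite [LHS]dual_cramer3 [RHS]dual_cramer3 !dotZl.
have -> : dot (S d) x = 1 by rewrite S_sym S_x.
have -> : det3 c e x * dot (S d) b = dot (cross c e) b.
  have [acx _] := pb; apply: (mulfI acx).
  by rewrite mulrCA S_sym (pole_dot _ pb) mulrC -eq_c mulrC (det3_cyc b c e).
have -> : dot (S d) c = 0.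
  have [bdx _] := pc; apply: (mulfI bdx); rewrite S_sym (pole_dot _ pc).
  by coord; ring.
by rewrite mulr0 mulr1 (_ : dot (cross c e) c = 0) //; coord; ring.
Qed.

(** Since d lies on the polars of c and e, its own polar passes through c and e. That [det3 c e x]
    is nonzero is a consequence: otherwise [cross c e] would vanish. *)
Lemma pole_close b c d e f : det3 c d e != 0 -> wt d = 1 ->
  pole b c d -> pole d e f -> pole c d e.
Proof.
move=> cde wd pc pe; have ce : cross c e != 0.
  apply: (@det3_neq0_cross _ _ d); rewrite -oppr_eq0.
  by rewrite (_ : - _ = det3 c d e) //; coord; ring.
suff e0 : det3 c e x *: S d = cross c e.
  by split=> //; apply: contraNneq ce => cex; rewrite -e0 cex scale0r.
rewrite dual_cramer3.
have -> : dot (S d) x = 1 by rewrite S_sym S_x.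
have -> : dot (S d) c = 0.
  have [bdx _] := pc; apply: (mulfI bdx); rewrite S_sym (pole_dot _ pc).
  by coord; ring.
have -> : dot (S d) e = 0.
  have [dfx _] := pe; apply: (mulfI dfx); rewrite S_sym (pole_dot _ pe).
  by coord; ring.
by rewrite !scale0r !add0r scale1r.
Qed.

(** Both sides equal [det3 a c x * det3 c e x * dot (S b) d]. *)
Lemma pole_axis a b c d e : pole a b c -> pole c d e -> on_axis a b c d e x.
Proof.
move=> pb pd; rewrite /on_axis (det3_cyc b c e).
rewrite -(pole_dot b pd) -(pole_dot d pb) S_sym.
ring.
Qed.

End Polarity.

End Space.

(** * Induction around the polygon *)

Section Polygon.
Variables (k : fieldType) (m : nat) (p : 'Z_m -> 'rV[k]_3) (x : 'rV[k]_3).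
Hypothesis m_ge5 : (5 <= m)%N.
Hypothesis x0 : x != 0.
Hypothesis gen : forall i,
  generic_five (p (i - 2)) (p (i - 1)) (p i) (p (i + 1)) (p (i + 2)).

Let axis_at i :=
  on_axis (p (i - 2)) (p (i - 1)) (p i) (p (i + 1)) (p (i + 2)) x.

Lemma all_on_axis :
  (forall i : 'Z_m, (1 <= i <= m - 3)%N -> axis_at i) -> forall i, axis_at i.
Proof.
move=> axes.
have m_gt1 : (1 < m)%N by apply: leq_trans m_ge5.
have wp i : wt (p i) = 1 by case: (gen_weight (gen i)).
have axisN j : (1 <= j <= m - 3)%N -> axis_at j%:R.
  move=> jm; apply: axes; rewrite val_Zp_nat // modn_small //.
  case/andP: jm => _ /leq_ltn_trans; apply.
  by rewrite ltn_subrL (leq_trans _ m_ge5).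
have sub2 i : i - 2 = i - 1 - 1 :> 'Z_m by ring.
have add2 i : i + 2 = i + 1 + 1 :> 'Z_m by ring.
(* As m - 3 is at least 2, the axes at 1 and 2 are both available; they give the nondegeneracy
   needed to build [S] from p 0 and p 1. *)
have eq1 : axis_at 1.
  by apply: (axisN 1%N); rewrite leq_subRL ?(leq_trans _ m_ge5).
have eq2 : axis_at 2.
  by apply: (axisN 2%N); rewrite leq_subRL ?(leq_trans _ m_ge5).
have g1 := gen 1; have g2 := gen 2.
rewrite /axis_at (_ : 1 - 2 = -1 :> 'Z_m) ?subrr in eq1 g1; last by ring.
rewrite /axis_at subrr (_ : 2 - 1 = 1 :> 'Z_m) in eq2 g2; last by ring.
rewrite (_ : 1 + 1 = 2 :> 'Z_m) in eq1 g1; last by ring.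
rewrite (_ : 2 + 1 = 1 + 2 :> 'Z_m) in eq2 g2; last by ring.
have [E0 E1] := two_axes_avoid_sides x0 g1 g2 eq1 eq2.
have F0 := axis_eq_side g1 eq1 E0.
have [S [S_sym S_x pole0 pole1]] :=
  polarity_exists (wp _) (wp _) E0 E1 F0.
pose pole_at i := pole x S (p (i - 1)) (p i) (p (i + 1)).
(* Along with the pole, the axis equation carries the nonvanishing of [det3] at x from one line to
   the next but one. *)
have step i : axis_at i -> pole_at (i - 1) -> pole_at i -> pole_at (i + 1).
  rewrite /axis_at /pole_at subrK addrK => eq_i pb pc.
  have [Ea _] := pb; rewrite -sub2 in pb Ea; rewrite -add2.
  have F := axis_eq_side (gen i) eq_i Ea.
  have Ed : det3 (p i) (p (i + 2)) x != 0.
    by rewrite -(mulf_eq_eq0 _ _ eq_i) ?(gen_bce (gen i)) ?(gen_acd (gen i)).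
  exact: (pole_step S_sym S_x F Ed (wp _) eq_i pb pc).
have poles j : (j.+1 <= m - 2)%N -> pole_at j%:R /\ pole_at j.+1%:R.
  elim: j => [_|j IHj jm].
    rewrite /pole_at sub0r add0r subrr -(_ : 2 = 1 + 1 :> 'Z_m); last by ring.
    by [].
  have [pj pj1] := IHj (ltnW jm); split=> //.
  rewrite -[j.+2]addn1 natrD; apply: step => //.
    apply: axisN; rewrite /= -ltnS (leq_trans jm) //.
    by rewrite -subSn ?(leq_trans _ m_ge5).
  by rewrite -[j.+1]addn1 natrD addrK.
have m0 : m%:R = 0 :> 'Z_m by exact: pchar_Zp.
have natN j : (j <= m)%N -> (m - j)%:R = - j%:R :> 'Z_m.
  by move=> jm; rewrite natrB // m0 sub0r.
(* The axis at m - 2 is not known yet, so the last vertex is reached from its neighbours -2 and 0 by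
   [pole_close]. *)
have pole_last : pole_at (- 1).
  have [|_] := poles (m - 3)%N; first by rewrite -subSn ?(leq_trans _ m_ge5).
  rewrite -subSn ?(leq_trans _ m_ge5) // subSS natN ?(leq_trans _ m_ge5) //.
  rewrite /pole_at.
  rewrite (_ : - 2 - 1 = - 1 - 1 - 1 :> 'Z_m); last by ring.
  rewrite (_ : - 2 + 1 = - 1 :> 'Z_m); last by ring.
  rewrite (_ : - 2%:R = - 1 - 1 :> 'Z_m); last by ring.
  have := gen_bcd (gen (- 1)).
  rewrite addNr => gen_1 pole_2.
  exact: (pole_close S_sym S_x gen_1 (wp _) pole_2 pole0).
have all_poles i : pole_at i.
  rewrite -(natr_Zp i); have [im|im] := leqP i (m - 2).
    case: (nat_of_ord i) im => [|j] jm; last by case: (poles j jm).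
    by have [|//] := poles 0%N; rewrite leq_subRL ?(leq_trans _ m_ge5).
  suff -> : nat_of_ord i = (m - 1)%N by rewrite natN ?(leq_trans _ m_ge5).
  have i_lt := leq_trans (ltn_ord i) (eq_leq (Zp_cast m_gt1)).
  lia.
move=> i; have := all_poles (i - 1); have := all_poles (i + 1).
rewrite /pole_at -sub2 -add2 subrK addrK => pd pb.
exact: (pole_axis S_sym pb pd).
Qed.

End Polygon.

(** * From the hypotheses on affine points to vectors, and conclusion *)

Lemma cross_affine (k : fieldType) (a b : 'rV[k]_3) : wt a = 1 -> wt b = 1 ->
  a != b -> cross a b != 0.
Proof.
move=> wa wb; apply: contraNneq => ab0; apply/eqP.
have := congr1 (fun v : 'rV_3 => v 0 0) ab0.
have := congr1 (fun v : 'rV_3 => v 0 1) ab0.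
rewrite /= !crossE !mxE; move: (wa) (wb); rewrite /wt => -> ->.
rewrite !mulr1 !mul1r => /eqP; rewrite subr_eq0 => /eqP e0 /eqP.
by rewrite subr_eq0 => /eqP e1; apply: row3P; rewrite // [LHS]wa -[LHS]wb.
Qed.

Lemma collinear_lines (k : fieldType) (a c e : 'rV[k]_3) :
  cross a c != 0 -> cross c e != 0 -> det3 a c e = 0 ->
  (<[a]> + <[c]> = <[c]> + <[e]>)%VS.
Proof.
move=> ac ce ace; apply/eqP; rewrite eqEsubv !subv_add addvSr addvSl /= andbT.
by rewrite -!memvE !mem_line // -det3_cyc ace eqxx.
Qed.

(** By [quadE2], the vector of [meet_diagonals] has weight [quad a b c d]. *)
Lemma parallel_diagonals (k : fieldType) (a b c d : 'rV[k]_3) :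
  wt a = 1 -> wt b = 1 -> wt c = 1 -> wt d = 1 ->
  det3 a b d != 0 -> det3 a c d != 0 ->
  parallel (<[a]> + <[c]>)%VS (<[b]> + <[d]>)%VS = (quad a b c d == 0).
Proof.
move=> wa wb wc wd abd acd.
rewrite /parallel meet_diagonals // -memvE mem_linf quadE2 //; congr (_ == _).
by move: wb wd; rewrite /wt !mxE => -> ->; rewrite !mulr1.
Qed.

Definition lift_affine (k : fieldType) (a : 'rV[k]_2) : 'rV[k]_3 :=
  row_mx a (1 : 'rV[k]_1).

Lemma wt_lift (k : fieldType) (a : 'rV[k]_2) : wt (lift_affine a) = 1.
Proof.
rewrite /wt (_ : 2 = rshift 2 (0 : 'I_1) :> 'I_(2 + 1)); last exact: val_inj.
by rewrite [LHS]row_mxEr mxE.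
Qed.

Lemma lift_inj (k : fieldType) : injective (@lift_affine k).
Proof. by move=> a b ab; have [] := @eq_row_mx k 1 2 1 a 1 b 1 ab. Qed.

Lemma is_pointP (k : fieldType) (X : {vspace 'rV[k]_3}) : is_point X ->
  exists2 x, x != 0 & X = <[x]>%VS.
Proof.
move=> /eqP dX; exists (vpick X).
  by rewrite vpick0 -dimv_eq0 dX.
apply/esym/eqP; rewrite eqEdim dX dim_vline -memvE memv_pick /=.
by rewrite vpick0 -dimv_eq0 dX.
Qed.

Theorem theorem9 (k : fieldType) (n : nat) (n_ge5 : (5 <= n)%N)
    (A : 'Z_n -> 'rV[k]_2) (A_inj : injective A)
    (l : 'Z_n -> {vspace 'rV[k]_3})
    (l_def : forall i, l i = (aff (A (i - 1)%R) + aff (A (i + 1)%R))%VS)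
    (A_notin : forall i, [/\ ~~ (aff (A i) <= l (i - 2)%R)%VS,
                             ~~ (aff (A i) <= l i)%VS
                           & ~~ (aff (A i) <= l (i + 2)%R)%VS])
    (l_neq : forall i : 'Z_n, l (i - 1) != l (i + 1))
    (l_npar : forall i, ~~ parallel (l i) (l (i + 1)))
    (B : 'Z_n -> {vspace 'rV[k]_3}) (* B i is B_{i,i+1} *)
    (B_def : forall i, B i = (l i :&: l (i + 1)%R)%VS)
    (C : 'Z_n -> {vspace 'rV[k]_3})
    (C_def : forall i, is_bracket (l i)
       (aff (A (i - 1))) (B (i - 1)) (B i) (aff (A (i + 1))) (C i))
    (g : 'Z_n -> {vspace 'rV[k]_3})
    (g_def : forall i, g i = (aff (A i) + C i)%VS)
    (X : {vspace 'rV[k]_3}) (X_point : is_point X)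
    (g_pencil : forall i : 'Z_n, (1 <= i <= n - 3)%N -> g i \in pencil X) :
  [/\ g (n - 2)%:R \in pencil X, g (n - 1)%:R \in pencil X
    & g n%:R \in pencil X].
Proof.
have [x x0 XE] := is_pointP X_point.
pose p i := lift_affine (A i).
have affE i : aff (A i) = <[p i]>%VS by [].
have wp i : wt (p i) = 1 by exact: wt_lift.
have n_gt1 : (1 < n)%N by apply: leq_trans n_ge5.
have sub2 i : i - 2 = i - 1 - 1 :> 'Z_n by ring.
have add2 i : i + 2 = i + 1 + 1 :> 'Z_n by ring.
(* This makes A (i - 1) and A (i + 1) distinct, so that [l i] is a line. *)
have two_neq0 : 2 != 0 :> 'Z_n.
  apply/eqP => e; have := val_Zp_nat n_gt1 2.
  by rewrite e modn_small ?(leq_trans _ n_ge5).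
have side i : cross (p (i - 1)) (p (i + 1)) != 0.
  apply: cross_affine => //; rewrite (inj_eq (@lift_inj k)) (inj_eq A_inj).
  rewrite -subr_eq0 (_ : _ - _ = - 2 :> 'Z_n) ?oppr_eq0 //.
  by ring.
have lE i : l i = (<[p (i - 1)%R]> + <[p (i + 1)%R]>)%VS by rewrite l_def.
have notin i j :
    ~~ (aff (A i) <= l j)%VS = (det3 (p (j - 1)) (p (j + 1)) (p i) != 0).
  by rewrite affE lE -memvE mem_line.
(* [nt], [nr], [nq] and [nr'] translate (i), [ns] translates (iii) and [nu] translates (ii). *)
have nt i : det3 (p (i - 1)) (p i) (p (i + 1)) != 0.
  by have [_ + _] := A_notin i; rewrite notin det3_swap oppr_eq0.
have nr i : det3 (p (i - 2)) (p i) (p (i + 1)) != 0.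
  have [+ _ _] := A_notin (i + 1); rewrite notin.
  rewrite (_ : i + 1 - 2 = i - 1 :> 'Z_n); last by ring.
  by rewrite subrK -sub2.
have nq i : det3 (p (i - 1)) (p i) (p (i + 2)) != 0.
  have [_ _] := A_notin (i - 1); rewrite notin.
  rewrite (_ : i - 1 + 2 = i + 1 :> 'Z_n); last by ring.
  by rewrite addrK -add2 -det3_cyc.
have nr' i : det3 (p (i - 1)) (p (i + 1)) (p (i + 2)) != 0.
  have := nr (i + 1); rewrite -add2.
  by rewrite (_ : i + 1 - 2 = i - 1 :> 'Z_n); last by ring.
have ns i : quad (p (i - 1)) (p i) (p (i + 1)) (p (i + 2)) != 0.
  by have := l_npar i; rewrite !lE addrK -add2 parallel_diagonals.
have nu i : det3 (p (i - 2)) (p i) (p (i + 2)) != 0.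
  apply: contraNneq (l_neq i) => u0; apply/eqP.
  rewrite !lE subrK addrK -sub2 -add2.
  apply: collinear_lines => //.
    by have := side (i - 1); rewrite subrK -sub2.
  by have := side (i + 1); rewrite addrK -add2.
have gen i : generic_five (p (i - 2)) (p (i - 1)) (p i) (p (i + 1)) (p (i + 2)).
  have s1 := ns (i - 1); have q1 := nq (i - 1).
  rewrite subrK -sub2 in s1 q1; rewrite (_ : i - 1 + 2 = i + 1) in s1 q1.
    by split.
  by ring.
have BE i : B i = ((<[p (i - 1)%R]> + <[p (i + 1)%R]>)
    :&: (<[p i]> + <[p (i + 2)%R]>))%VS.
  by rewrite B_def !lE addrK -add2.
(* The auxiliary point of [is_bracket] may vary with i; [axis_pencil] holds for every choice of
   it. *)
have pencilP i :
    on_axis (p (i - 2)) (p (i - 1)) (p i) (p (i + 1)) (p (i + 2)) x <->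
    g i \in pencil X.
  have [a a_notin CE] := C_def i.
  move: a_notin; rewrite g_def XE CE !BE subrK -sub2.
  rewrite (_ : i - 1 + 2 = i + 1 :> 'Z_n); last by ring.
  rewrite lE !affE => a_notin.
  exact: rwP (axis_pencil x (gen i) (wt_lift a) a_notin).
have all_axes i := all_on_axis n_ge5 x0 gen
  (fun j jm => (pencilP j).2 (g_pencil j jm)) i.
by split; apply/pencilP/all_axes.
Qed.
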